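(* Let $(M,F)$ be a conic pseudo-Finsler surface with $F$ defined on the conic sub-bundle $\mathcal A$, let $\phi:\mathcal A\to\mathbb R$ be a smooth function positively homogeneous of degree $0$ in $y$, and let $\overline F=e^{\phi}F$. Then $\overline g_{ij}:=\tfrac12\dot\partial_i\dot\partial_j\overline F^2$ satisfies $$\overline g_{ij}=e^{2\phi}\big[g_{ij}+\phi_{;2}(\ell_im_j+\ell_jm_i)+\sigma\,m_im_j\big]=e^{2\phi}\big[\ell_i\ell_j+\phi_{;2}(\ell_im_j+\ell_jm_i)+(\sigma+\varepsilon)\,m_im_j\big],$$ where $\sigma=\phi_{;2;2}+\varepsilon\mathcal I\phi_{;2}+2(\phi_{;2})^2$.
   Context: Let $M$ be a smooth 2-dimensional manifold, $(x^1,x^2)$ local coordinates and $(x^i,y^i)$ the induced coordinates on $TM$; all formulas are in such a coordinate system and repeated indices are summed over $\{1,2\}$. Write $\dot\partial_i=\partial/\partial y^i$. A function is $h(r)$ if it is positively homogeneous of degree $r$ in $y$. A conic sub-bundle is a non-empty open subset $\mathcal A\subset TM\setminus 0$ projecting onto $M$ and closed under multiplication by positive scalars. A conic pseudo-Finsler metric on $M$ is a smooth $h(1)$ function $F:\mathcal A\to\mathbb R$ such that $g_{ij}=\tfrac12\dot\partial_i\dot\partial_jF^2$ is non-degenerate at each point of $\mathcal A$; $(g^{ij})$ is the inverse matrix. A conic pseudo-Finsler surface is equipped with its modified Berwald frame: $F$ is nowhere zero on $\mathcal A$, $\ell_i=\dot\partial_iF$, $\ell^i=y^i/F$, $\varepsilon\in\{1,-1\}$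 (the signature) is the sign of $\det(g_{ij})$, $m_1=-\sqrt{\varepsilon\det(g_{ij})}\,\ell^2$, $m_2=\sqrt{\varepsilon\det(g_{ij})}\,\ell^1$, $m^i=g^{ij}m_j$; thus $g_{ij}=\ell_i\ell_j+\varepsilon m_im_j$, $\ell^im_i=0$, $m^im_i=\varepsilon$. The main scalar $\mathcal I$ is defined by $F\,C_{ijk}=\mathcal I\,m_im_jm_k$, where $C_{ijk}=\tfrac12\dot\partial_kg_{ij}$. For a smooth function $f$ on $\mathcal A$, $f_{;2}:=\varepsilon F(\dot\partial_if)m^i$ and $f_{;2;2}:=(f_{;2})_{;2}$. *)

(* Defs.v *)
From mathcomp Require Import all_boot all_order all_algebra.
From mathcomp Require Import all_classical all_reals all_analysis.

Set Implicit Arguments.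
Unset Strict Implicit.
Unset Printing Implicit Defensive.

Import Order.TTheory GRing.Theory Num.Theory.
Import numFieldNormedType.Exports.
Local Open Scope classical_set_scope.
Local Open Scope ring_scope.

(* Derivatives in all directions are required, which on a finite-dimensional  *)
(* space amounts to continuity of all iterated partial derivatives.           *)
Fixpoint Cn_on (R : realType) (V : normedModType R) (n : nat) (D : set V)
    (f : V -> R) : Prop :=
  (forall x, D x -> {for x, continuous f}) /\
  (if n is m.+1 then
     forall v : V, (forall x, D x -> derivable f x v) /\
                   Cn_on m D ('D_v f)
   else True).

Definition smooth_on (R : realType) (V : normedModType R) (D : set V)
  (f : V -> R) : Prop := forall n, Cn_on n D f.

(* [cinv] is only meaningful on the image of the chart. *)
Record chart (R : realType) (M : topologicalType) := Chart {
  cdom : set M;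
  cmap : M -> 'rV[R]_2;
  cinv : 'rV[R]_2 -> M;
  cdom_open : open cdom;
  cimage_open : open (cmap @` cdom);
  cmapK : forall p, cdom p -> cinv (cmap p) = p;
  cmap_continuous : forall p, cdom p -> {for p, continuous cmap};
  cinv_continuous : forall x, (cmap @` cdom) x -> {for x, continuous cinv}
}.

(* The atlas need not be maximal. *)
Record smooth_surface (R : realType) := SmoothSurface {
  carrier :> topologicalType;
  surface_hausdorff : hausdorff_space carrier;
  surface_second_countable : @second_countable carrier;
  atlas : set (chart R carrier);
  atlas_cover : forall p : carrier, exists2 c, atlas c & cdom c p;
  atlas_smooth : forall c c', atlas c -> atlas c' -> forall k : 'I_2,
    smooth_on (cmap c @` (cdom c `&` cdom c'))
      (fun x => cmap c' (cinv c x) 0 k)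
}.

Section TangentBundle.
Variables (R : realType) (M : smooth_surface R).
Implicit Types (c : chart R M).

(* A point of TM is a base point together with its fibre coordinates (y^i) in *)
(* every chart of the atlas around that point, related by the usual rule      *)
(* y'^j = (dx'^j/dx^i) y^i.  Fibre coordinates in irrelevant charts are set   *)
(* to 0, so that two equal tangent vectors are equal as terms.                *)
Record tangent := Tangent {
  tpt : M;
  tcoord : chart R M -> 'rV[R]_2;
  tcoord_out : forall c, ~ (atlas c /\ cdom c tpt) -> tcoord c = 0;
  tcoord_change : forall c c', atlas c -> atlas c' ->
    cdom c tpt -> cdom c' tpt ->
    tcoord c' = tcoord c *m 'J (cmap c' \o cinv c) (cmap c tpt)
}.

Definition is_zero_vector (v : tangent) : Prop := forall c, tcoord v c = 0.

Lemma tscale_out (a : R) (v : tangent) c :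
  ~ (atlas c /\ cdom c (tpt v)) -> a *: tcoord v c = 0.
Proof. by move=> /tcoord_out ->; rewrite scaler0. Qed.

Lemma tscale_change (a : R) (v : tangent) c c' : atlas c -> atlas c' ->
  cdom c (tpt v) -> cdom c' (tpt v) ->
  a *: tcoord v c' =
  (a *: tcoord v c) *m 'J (cmap c' \o cinv c) (cmap c (tpt v)).
Proof.
by move=> ac ac' cv c'v; rewrite (tcoord_change ac ac' cv c'v) scalemxAl.
Qed.

Definition tscale (a : R) (v : tangent) : tangent :=
  @Tangent (tpt v) (fun c => a *: tcoord v c)
    (@tscale_out a v) (@tscale_change a v).

(* The induced coordinates (x, y). *)
Definition tcoords c (v : tangent) : 'rV[R]_2 * 'rV[R]_2 :=
  (cmap c (tpt v), tcoord v c).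

Definition coord_image c (A : set tangent) : set ('rV[R]_2 * 'rV[R]_2) :=
  tcoords c @` (A `&` [set v | cdom c (tpt v)]).

(* The function on A with values f, read in the induced coordinates of c; the *)
(* value is 0 (and irrelevant) outside [coord_image c A].                     *)
Definition local_rep c (A : set tangent) (f : tangent -> R)
    (z : 'rV[R]_2 * 'rV[R]_2) : R :=
  xget 0 (f @` (A `&` [set v | cdom c (tpt v) /\ tcoords c v = z])).

Definition tangent_open (A : set tangent) : Prop :=
  forall c, atlas c -> open (coord_image c A).

Definition tangent_smooth (A : set tangent) (f : tangent -> R) : Prop :=
  forall c, atlas c -> smooth_on (coord_image c A) (local_rep c A f).

Definition pos_homogeneous (r : R) (A : set tangent) (f : tangent -> R) : Prop :=
  forall (a : R) (v : tangent), 0 < a -> A v -> f (tscale a v) = a `^ r * f v.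

Definition conic_subbundle (A : set tangent) : Prop :=
  [/\ A !=set0, tangent_open A,
      (forall v, A v -> ~ is_zero_vector v),
      (forall p : M, exists2 v, A v & tpt v = p) &
      (forall (a : R) (v : tangent), 0 < a -> A v -> A (tscale a v))].

End TangentBundle.

(* In this section F and f are functions of the induced coordinates z = (x,y);*)
(* the indices 1, 2 are the elements 0, 1 of 'I_2.                            *)
Section BerwaldFrame.
Variable R : realType.
Local Notation coords := ('rV[R]_2 * 'rV[R]_2)%type.
Implicit Types (F f : coords -> R) (z : coords) (i j k : 'I_2).

Definition dotd i f z : R := 'D_((0, delta_mx 0 i) : coords) f z.

Definition metric F i j z : R :=
  2^-1 * dotd i (dotd j (fun w => F w ^+ 2)) z.

Definition metric_mx F z : 'M[R]_2 := \matrix_(i, j) metric F i j z.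

Definition signature F z : R := Num.sg (\det (metric_mx F z)).

Definition ell_low F i z : R := dotd i F z.

Definition ell_up F i z : R := z.2 0 i / F z.

Definition m_low F i z : R :=
  let s := Num.sqrt (signature F z * \det (metric_mx F z)) in
  if i == 0 then - s * ell_up F 1 z else s * ell_up F 0 z.

Definition m_up F i z : R :=
  \sum_(j < 2) invmx (metric_mx F z) i j * m_low F j z.

Definition cartan F i j k z : R := 2^-1 * dotd k (metric F i j) z.

Definition main_scalar F z : R :=
  xget 0 [set t : R | forall i j k,
    F z * cartan F i j k z = t * m_low F i z * m_low F j z * m_low F k z].

Definition semi2 F f z : R :=
  signature F z * F z * \sum_(i < 2) dotd i f z * m_up F i z.

End BerwaldFrame.

Definition conic_pseudo_finsler (R : realType) (M : smooth_surface R)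
    (A : set (tangent M)) (F : tangent M -> R) : Prop :=
  [/\ conic_subbundle A, tangent_smooth A F, pos_homogeneous 1 A F &
      forall c : chart R M, atlas c -> forall z, coord_image c A z ->
        metric_mx (local_rep c A F) z \in unitmx].

(* Main.v *)
(* The indicatrix of a surface is one-dimensional, so homogeneity alone forces *)
(* vertical derivatives to be multiples of n = (-y^2, y^1), the annihilator of *)
(* y: with phi of degree 0 and F of degree 1 one has                          *)
(*   d_i phi = a n_i,  d_i d_j F = kappa n_i n_j,  det g = F^3 kappa,         *)
(*   m_i = (s / F) n_i  where s = sqrt |det g|.                               *)
(* (In particular no symmetry of second derivatives is needed.)  Euler's      *)
(* relations for a (degree -2) and kappa (degree -3) likewise give            *)
(*   F d_k kappa + 3 kappa d_k F = b n_k,  F d_k a + 2 a d_k F = c n_k,       *)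
(* and then phi_;2 = a F^2 / s, I = F^4 b / (2 s^3),                          *)
(* phi_;2;2 = (F c / s - eps a F^4 b / (2 s^3)) F^2 / s; expanding            *)
(* d_i d_j (e^(2 phi) F^2) in these terms gives the formula.                  *)

Require Import Defs.
From mathcomp Require Import all_boot all_order all_algebra.
From mathcomp Require Import all_classical all_reals all_analysis.
From mathcomp Require Import ring lra.
Import Order.TTheory GRing.Theory Num.Theory.
Import numFieldNormedType.Exports.
Local Open Scope classical_set_scope.
Local Open Scope ring_scope.

Set Implicit Arguments.
Unset Strict Implicit.
Unset Printing Implicit Defensive.

(** * Directional derivatives *)

Section DirectionalDerivatives.
Context {R : realType} {V : normedModType R}.
Implicit Types (f g : V -> R) (x u v : V) (D : set V).

(** On each fibre $y \ne 0$, and $n = (-y^2, y^1)$ spans the covectors annihilating $y$. Euler's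
    relation turns a degree condition into the vanishing of a contraction with $y$, and in dimension
    two such a covector is one scalar times $n$. So the gradient of $\phi$, the Hessian of $F$ and
    the Cartan tensor each reduce to a scalar ([grad_coefE], [hess_coefE], [cartanE]), and $m_i$ is
    proportional to $n_i$ ([m_lowE]).

    After expanding $\frac12\dot\partial_i\dot\partial_j(e^{2\phi}F^2)$ ([metric_conformal]), the
    term to understand is $F^2\dot\partial_i\dot\partial_j\phi$. With $\dot\partial_j\phi = a n_j$,
    the derivative of $a$ is $-2a\ell/F$ up to a multiple of $n$ ([grad_slope]), and that of $n$ is
    given by [normal_dirE]. All terms then collapse to $aF(\ell_i n_j + \ell_j n_i) + (Fc +
    2a^2F^2)n_i n_j$. [conformal_coefficients] recognises $\phi_{;2}$ and $\sigma$ here: the summand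
    $\varepsilon\mathcal I\phi_{;2}$ of $\sigma$ compensates the derivative of $\sqrt{|\det g|}$
    hidden in $\phi_{;2;2}$. The second form follows from $g_{ij} = \ell_i\ell_j + \varepsilon m_i
    m_j$. *)

Lemma is_derive_lineP f x v (t d : R) :
  is_derive t 1 (fun s : R => f (s *: v + x)) d <->
  is_derive (t *: v + x) v f d.
Proof.
(* The two difference quotients are the same function of [h], so existence and value of the limit
   transfer together. *)
have E : (fun h : R => h^-1 *: (((fun s : R => f (s *: v + x)) \o shift t) (h *: 1)
      - f (t *: v + x))) =
    (fun h => h^-1 *: ((f \o shift (t *: v + x)) (h *: v) - f (t *: v + x))).
  by apply/funext => h /=; rewrite scaler1 scalerDl addrA.
by split=> -[dv e]; split; move: dv e; rewrite /derivable /derive E.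
Qed.

Lemma is_derive_lineP0 f x v (d : R) :
  is_derive (0 : R) (1 : R) (fun s : R => f (s *: v + x)) d <-> is_derive x v f d.
Proof. by rewrite is_derive_lineP scale0r add0r. Qed.

Lemma is_derive_chain f x v (g : R -> R) (d e : R) :
  is_derive x v f d -> is_derive (f x) (1 : R) g e -> is_derive x v (g \o f) (e * d).
Proof.
move=> /is_derive_lineP0 df dg; apply/is_derive_lineP0.
apply: (@is_derive1_comp _ g (fun s : R => f (s *: v + x))).
by rewrite scale0r add0r.
Qed.

Lemma is_derive_dirZ f x v (k d : R) :
  is_derive x v f d -> is_derive x (k *: v) f (k * d).
Proof.
move=> /is_derive_lineP0 df; apply/is_derive_lineP0.
have -> : (fun s : R => f (s *: (k *: v) + x)) =
    (fun s : R => f (s *: v + x)) \o (fun s => k * s).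
  by apply/funext => s /=; rewrite scalerA mulrC.
rewrite mulrC; apply: is_derive1_comp; first by rewrite mulr0.
have := is_deriveZ k (is_derive_id (0 : R^o) (1 : R^o)).
by rewrite /GRing.scale/= mulr1.
Qed.

(** Smoothness is phrased through directional derivatives, so additivity in the direction needs a
    proof. The increment along $hu + hv$ is split at $x + hu$: the first piece is the derivative
    along [u] at [x]; the second is handled by the mean value theorem and continuity of ['D_v f] at
    [x]. *)
Lemma is_derive_dirD f D x u v : open D -> D x -> derivable f x u ->
  (forall y, D y -> derivable f y v) -> {for x, continuous ('D_v f)} ->
  is_derive x (u + v) f ('D_u f x + 'D_v f x).
Proof.
move=> oD Dx /derivableP [du _] dv cv.
suff H : (fun h : R => h^-1 *: ((f \o shift x) (h *: (u + v)) - f x)) @ 0^'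
    --> 'D_u f x + 'D_v f x.
  by split; [apply/cvg_ex; exists ('D_u f x + 'D_v f x)|exact: cvg_lim H].
have -> : (fun h : R => h^-1 *: ((f \o shift x) (h *: (u + v)) - f x)) =
    (fun h : R => h^-1 *: ((f \o shift x) (h *: u) - f x)) +
    (fun h : R => h^-1 *: (f (h *: v + (h *: u + x)) - f (h *: u + x))).
  apply/funext => h; rewrite addrfctE /= -scalerDr (scalerDr h u v); congr (_ *: _).
  rewrite (addrC (h *: u) (h *: v)) -(addrA (h *: v)).
  by rewrite [RHS]addrC [RHS]addrA subrK.
apply: cvgD; first exact: du.
apply/cvgrPdist_lt => e e0.
have /cvgrPdist_lt /(_ e e0) := cv.
rewrite -[X in _ -> X]/(nbhs _ _) => E.
have : nbhs x (D `&` [set t | `|'D_v f x - 'D_v f t| < e]).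
  by apply: filterI => //; exact: open_nbhs_nbhs.
move=> /nbhs_ballP [d /= d0 dB].
(* The summand 1 keeps the denominator positive even if [u] and [v] both vanish. *)
have w0 : 0 < `|u| + `|v| + 1 by rewrite ltr_wpDl ?addr_ge0.
near=> h.
have h0 : h != 0 by near: h; exact: nbhs_dnbhs_neq.
have hd : `|h| < d / (`|u| + `|v| + 1).
  near: h; apply: dnbhs0_lt; exact: divr_gt0.
(* The segment from $x + hu$ to $x + hu + hv$, which stays in the ball of radius [d] by the choice
   of [h]. *)
pose q c := c *: (h *: v) + (h *: u + x).
have inB (c : R) : c \in `[0, 1]%R -> (D `&` [set t | `|'D_v f x - 'D_v f t| < e]) (q c).
  rewrite in_itv/= => /andP[c0 c1]; apply: dB; rewrite -ball_normE /ball_/= /q.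
  rewrite addrA opprD addrA addrC addrA addNr add0r normrN.
  rewrite ltr_pdivlMr // in hd.
  apply: le_lt_trans hd.
  apply: le_trans (ler_normD _ _) _; rewrite !normrZ (ger0_norm c0).
  have hv0 : 0 <= `|h| * `|v| by rewrite mulr_ge0.
  have := ler_piMl hv0 c1; rewrite !mulrDr mulr1.
  move: (normr_ge0 h); move: (`|h| * `|v|) (`|h| * `|u|) => r1 r2 abs_ge0 le1.
  lra.
have dq (c : R) : c \in `[0, 1]%R ->
    is_derive c (1 : R) (fun s : R => f (s *: (h *: v) + (h *: u + x)))
      (h * 'D_v f (q c)).
  move=> /inB [Dq _]; apply/is_derive_lineP.
  by apply: is_derive_dirZ; apply/derivableP/dv.
have c01oo (c : R) : c \in `]0, 1[%R -> c \in `[0, 1]%R.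
  exact: subset_itv_oo_cc.
have cont : {within `[0, 1], continuous (fun s : R => f (s *: (h *: v) + (h *: u + x)))}.
  by apply: derivable_within_continuous => c /dq [].
have [c c01] := @MVT R (fun s : R => f (s *: (h *: v) + (h *: u + x)))
  (fun c => h * 'D_v f (q c)) 0 1 ltr01 (fun c cc => dq c (c01oo c cc)) cont.
rewrite scale1r scale0r add0r subr0 mulr1 => ->.
rewrite /GRing.scale/= mulrA mulVf // mul1r.
by have [] := inB c (c01oo c c01).
Unshelve. all: by end_near.
Qed.

End DirectionalDerivatives.

(** * Differentiation rules at a point *)

Section PointwiseRules.
Context {R : realType} {V : normedModType R}.
Implicit Types (f g : V -> R) (x v : V).

Lemma is_derive_fmul f g x v (a b : R) : is_derive x v f a -> is_derive x v g b ->
  is_derive x v (fun w => f w * g w) (a * g x + f x * b).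
Proof.
move=> df dg; have -> : a * g x + f x * b = f x *: b + g x *: a.
  by rewrite addrC /GRing.scale/= (mulrC a).
exact: (is_deriveM df dg).
Qed.

Lemma is_derive_fadd f g x v (a b : R) : is_derive x v f a -> is_derive x v g b ->
  is_derive x v (fun w => f w + g w) (a + b).
Proof. by move=> df dg; exact: (is_deriveD df dg). Qed.

Lemma is_derive_fopp f x v (a : R) : is_derive x v f a ->
  is_derive x v (fun w => - f w) (- a).
Proof. by move=> df; exact: (is_deriveN df). Qed.

Lemma is_derive_fsqr f x v (a : R) : is_derive x v f a ->
  is_derive x v (fun w => f w ^+ 2) (2 * f x * a).
Proof.
move=> df; have -> : 2 * f x * a = a * f x + f x * a by ring.
have -> : (fun w => f w ^+ 2) = (fun w => f w * f w).
  by apply/funext => w; rewrite expr2.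
exact: (is_derive_fmul df df).
Qed.

Lemma is_derive_finv f x v (a : R) : f x != 0 -> is_derive x v f a ->
  is_derive x v (fun w => (f w)^-1) (- a / f x ^+ 2).
Proof.
move=> f0 [df <-]; split; first exact: derivableV.
by rewrite deriveV// /GRing.scale/= mulNr mulrC mulNr.
Qed.

Lemma is_derive_fdiv f g x v (a b : R) : g x != 0 ->
  is_derive x v f a -> is_derive x v g b ->
  is_derive x v (fun w => f w / g w) ((a * g x - f x * b) / g x ^+ 2).
Proof.
move=> g0 df dg.
have -> : (a * g x - f x * b) / g x ^+ 2 = a * (g x)^-1 + f x * (- b / g x ^+ 2).
  by field.
exact: (is_derive_fmul df (is_derive_finv g0 dg)).
Qed.

(** Local representatives satisfy their identities only on the open coordinate image; this is how
    such identities are differentiated. *)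
Lemma is_derive_open_eq (D : set V) f g x v (a : R) : open D -> D x ->
  (forall w, D w -> f w = g w) -> is_derive x v f a -> is_derive x v g a.
Proof.
move=> oD Dx fg; apply: near_eq_is_derive.
have : nbhs x D by exact: open_nbhs_nbhs.
by apply: filterS.
Qed.

End PointwiseRules.

(** Away from 0 the sign is locally constant, so near [x] the function is the square root of a
    linear one. *)
Lemma is_derive_sqrt_abs {R : realType} (x : R) : x != 0 ->
  is_derive x (1 : R) (fun t : R => Num.sqrt (Num.sg t * t))
    (Num.sg x / (2 * Num.sqrt (Num.sg x * x))).
Proof.
move=> x0; have sx0 : 0 < Num.sg x * x by rewrite -normrEsg normr_gt0.
apply: (@near_eq_is_derive _ _ _ (Num.sqrt \o (fun t : R => Num.sg x * t))).
  near=> t => /=; congr (Num.sqrt (_ * _)).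
  have : `|x - t| < `|x|.
    by near: t; apply: nbhsx_ballx; rewrite normr_gt0.
  have [xp|xn|x_eq0] := ltgtP x 0; last by move: (x0); rewrite x_eq0 eqxx.
    rewrite (ltr0_norm xp) => /ltr_normlP [h1 h2].
    by rewrite !ltr0_sg//; lra.
  rewrite (gtr0_norm xn) => /ltr_normlP [h1 h2].
  by rewrite !gtr0_sg//; lra.
rewrite mulrC; apply: is_derive1_comp; first exact: is_derive1_sqrt.
have := is_deriveZ (Num.sg x) (is_derive_id (x : R^o) (1 : R^o)).
by rewrite /GRing.scale/= mulr1.
Unshelve. all: by end_near.
Qed.

(** * Homogeneous functions and Euler's relation *)

Section FibreCalculus.
Context {R : realType}.
Local Notation coords := ('rV[R]_2 * 'rV[R]_2)%type.
Implicit Types (f g : coords -> R) (z : coords) (D : set coords).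

Definition fibre_conic D := forall (a : R) z, 0 < a -> D z -> D (z.1, a *: z.2).

Definition fibre_homogeneous (r : R) D f := forall (a : R) z, 0 < a -> D z ->
  f (z.1, a *: z.2) = a `^ r * f z.

Definition fibre_dir (i : 'I_2) : coords := (0, delta_mx 0 i).

Lemma smooth_on_derive D f (v : coords) : smooth_on D f -> smooth_on D ('D_v f).
Proof. by move=> sf n; have [_ /(_ v) []] := sf n.+1. Qed.

Lemma smooth_on_is_derive D f z (v : coords) : smooth_on D f -> D z ->
  is_derive z v f ('D_v f z).
Proof. by move=> sf Dz; have [_ /(_ v) [dv _]] := sf 1%N; apply/derivableP/dv. Qed.

Lemma smooth_on_dotd D f i z : smooth_on D f -> D z ->
  is_derive z (fibre_dir i) f (dotd i f z).
Proof. exact: smooth_on_is_derive. Qed.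

Lemma smooth_onD D f z (u v : coords) : open D -> smooth_on D f -> D z ->
  'D_(u + v) f z = 'D_u f z + 'D_v f z.
Proof.
move=> oD sf Dz; apply: derive_val; apply: (is_derive_dirD oD Dz).
- by have [] := smooth_on_is_derive u sf Dz.
- by move=> y Dy; have [] := smooth_on_is_derive v sf Dy.
- by have [+ _] := smooth_on_derive v sf 0%N; apply.
Qed.

Lemma smooth_onZ D f z (k : R) (v : coords) : smooth_on D f -> D z ->
  'D_(k *: v) f z = k * 'D_v f z.
Proof.
by move=> sf Dz; apply: derive_val; apply: is_derive_dirZ; exact: smooth_on_is_derive.
Qed.

Lemma fibre_vectorE z :
  (0, z.2) = z.2 0 0 *: fibre_dir 0 + z.2 0 1 *: fibre_dir 1 :> coords.
Proof.
congr pair; first by rewrite /= !scaler0 addr0.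
apply/rowP => i /=; rewrite !mxE eqxx /=.
have [->|->] : i = 0 \/ i = 1.
  by case: i => [[|[|//]] lt2]; [left|right]; exact/val_inj.
- by rewrite mulr1 mulr0 addr0.
- by rewrite mulr1 mulr0 add0r.
Qed.

(** Differentiate $f(x,(1+s)y) = (1+s)^r f(x,y)$ at $s = 0$; the identity is available for $s$ near
    0, where $1+s > 0$. *)
Lemma euler_fibre r D f z : open D -> fibre_conic D -> smooth_on D f ->
  fibre_homogeneous r D f -> D z ->
  z.2 0 0 * dotd 0 f z + z.2 0 1 * dotd 1 f z = r * f z.
Proof.
move=> oD cD sf hf Dz.
rewrite /dotd -!(smooth_onZ _ _ sf Dz) -(smooth_onD _ _ oD sf Dz) -fibre_vectorE.
apply: derive_val; apply/is_derive_lineP0.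
apply: (@near_eq_is_derive _ _ _ (fun s : R => (1 + s) `^ r * f z)).
  near=> s; have s1 : 0 < 1 + s.
    suff : `|0 - s| < 1 by rewrite sub0r normrN => /ltr_normlP []; lra.
    by near: s; apply: nbhsx_ballx.
  rewrite -hf//; congr f; case: z {Dz} => x y /=.
  by congr pair; rewrite /= ?scaler0 ?add0r// scalerDl scale1r addrC.
have dp : is_derive (0 : R) (1 : R) (fun s : R => (1 + s) `^ r) r.
  have d1 : is_derive (0 : R) (1 : R) (fun s : R => 1 + s) (0 + 1).
    exact: is_derive_fadd.
  have d2 : is_derive (1 + 0 : R) (1 : R) (fun t => t `^ r) (r * (1 + 0) `^ (r - 1)).
    by apply: is_derive1_powR; rewrite addr0.
  by have := is_derive1_comp d2 d1; rewrite addr0 powR1 add0r !mulr1.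
by have := is_derive_fmul dp (is_derive_cst (f z) (0 : R) (1 : R)); rewrite mulr0 addr0.
Unshelve. all: by end_near.
Qed.

(** Differentiate $f(x,ay) = a^r f(x,y)$ in $y^i$: the left side gains a factor $a$, which is
    cancelled. *)
Lemma fibre_homogeneous_dotd r D f i : open D -> fibre_conic D -> smooth_on D f ->
  fibre_homogeneous r D f -> fibre_homogeneous (r - 1) D (dotd i f).
Proof.
move=> oD cD sf hf a z a0 Dz.
have Daz := cD a z a0 Dz.
suff : a * dotd i f (z.1, a *: z.2) = a `^ r * dotd i f z.
  move=> H; apply: (mulfI (lt0r_neq0 a0)); rewrite H mulrA; congr (_ * _).
  rewrite -[X in _ = X * _](powRr1 (ltW a0)) -powRD ?(gt_eqF a0)//; last by rewrite implybT.
  by rewrite addrC subrK.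
rewrite -(smooth_onZ _ _ sf Daz); apply: derive_val.
have : is_derive z (fibre_dir i) (fun w => f (w.1, a *: w.2)) (a `^ r * dotd i f z).
  apply: (is_derive_open_eq oD Dz (f := fun w => a `^ r * f w)).
    by move=> w Dw; rewrite hf.
  have := is_derive_fmul (is_derive_cst (a `^ r) z (fibre_dir i))
                         (smooth_on_dotd i sf Dz).
  by rewrite mul0r add0r.
move=> /is_derive_lineP0 H; apply/is_derive_lineP0.
have <- : (fun s : R => f ((s *: fibre_dir i + z).1, a *: (s *: fibre_dir i + z).2)) =
  (fun s => f (s *: (a *: fibre_dir i) + (z.1, a *: z.2))); last exact: H.
apply/funext => s; congr f; case: z {H Daz Dz} => x y.
congr pair; rewrite /=; first by rewrite !scaler0.
by rewrite scalerDr !scalerA mulrC.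
Qed.

End FibreCalculus.

(** * Pointwise Euler relations and their two-dimensional consequences *)

Section Fibre.
Context {R : realType}.
Local Notation coords := ('rV[R]_2 * 'rV[R]_2)%type.
Implicit Types (f g F : coords -> R) (z : coords) (D : set coords) (i j k : 'I_2).

Lemma ord2P i : i = 0 \/ i = 1.
Proof. by case: i => [[|[|//]] lt2]; [left|right]; exact/val_inj. Qed.

Lemma dotd_derivable f z k : derivable f z (fibre_dir k) ->
  is_derive z (fibre_dir k) f (dotd k f z).
Proof. by move/derivableP. Qed.

Lemma dotd_val f z k d : is_derive z (fibre_dir k) f d -> dotd k f z = d.
Proof. by case. Qed.

Lemma smooth_on_dotd_smooth D f i : smooth_on D f -> smooth_on D (dotd i f).
Proof. exact: smooth_on_derive. Qed.

#[local] Opaque dotd.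

(* Euler's relation at a single point: unlike homogeneity, it is inherited by *)
(* quotients without discussing domains.                                      *)
Definition fibre_euler (r : R) f z :=
  (forall k, derivable f z (fibre_dir k)) /\
  z.2 0 0 * dotd 0 f z + z.2 0 1 * dotd 1 f z = r * f z.

Lemma fibre_eulerM r s f g z : fibre_euler r f z -> fibre_euler s g z ->
  fibre_euler (r + s) (fun w => f w * g w) z.
Proof.
move=> [df ef] [dg eg]; have H k :=
  is_derive_fmul (dotd_derivable (df k)) (dotd_derivable (dg k)).
split=> [k|]; first by have [] := H k.
rewrite (dotd_val (H 0)) (dotd_val (H 1)).
transitivity ((z.2 0 0 * dotd 0 f z + z.2 0 1 * dotd 1 f z) * g z +
  f z * (z.2 0 0 * dotd 0 g z + z.2 0 1 * dotd 1 g z)); last first.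
  by rewrite ef eg; move: (f z) (g z) => x y; ring.
move: (dotd 0 f z) (dotd 1 f z) (dotd 0 g z) (dotd 1 g z) (z.2 0 0) (z.2 0 1).
by move: (f z) (g z) => x y a b c d y0 y1; ring.
Qed.

Lemma fibre_eulerD r f g z : fibre_euler r f z -> fibre_euler r g z ->
  fibre_euler r (fun w => f w + g w) z.
Proof.
move=> [df ef] [dg eg]; have H k :=
  is_derive_fadd (dotd_derivable (df k)) (dotd_derivable (dg k)).
split=> [k|]; first by have [] := H k.
by rewrite (dotd_val (H 0)) (dotd_val (H 1)) !mulrDr addrACA ef eg.
Qed.

Lemma fibre_eulerN r f z : fibre_euler r f z -> fibre_euler r (fun w => - f w) z.
Proof.
move=> [df ef]; have H k := is_derive_fopp (dotd_derivable (df k)).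
split=> [k|]; first by have [] := H k.
by rewrite (dotd_val (H 0)) (dotd_val (H 1)) !mulrN -opprD ef.
Qed.

Lemma fibre_eulerV r f z : f z != 0 -> fibre_euler r f z ->
  fibre_euler (- r) (fun w => (f w)^-1) z.
Proof.
move=> f0 [df ef]; have H k := is_derive_finv f0 (dotd_derivable (df k)).
split=> [k|]; first by have [] := H k.
rewrite (dotd_val (H 0)) (dotd_val (H 1)).
transitivity (- (z.2 0 0 * dotd 0 f z + z.2 0 1 * dotd 1 f z) / f z ^+ 2).
  move: (dotd 0 f z) (dotd 1 f z) (z.2 0 0) (z.2 0 1) (f z) f0.
  by move=> a b y0 y1 x x0; field.
by rewrite ef; move: (f z) f0 => x x0; field.
Qed.

Lemma is_derive_coord z j k :
  is_derive z (fibre_dir k) (fun w : coords => w.2 0 j) (j == k)%:R.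
Proof.
apply/is_derive_lineP0.
have -> : (fun s : R => (s *: fibre_dir k + z).2 0 j) =
    (fun s => (j == k)%:R * s + z.2 0 j).
  by apply/funext => s; rewrite /= !mxE eqxx /= mulrC.
have := is_derive_fadd (is_deriveZ ((j == k)%:R : R) (is_derive_id (0 : R) (1 : R^o)))
  (is_derive_cst (z.2 0 j) (0 : R) (1 : R)).
by rewrite /GRing.scale/= mulr1 addr0.
Qed.

Lemma fibre_euler_coord j z : fibre_euler 1 (fun w : coords => w.2 0 j) z.
Proof.
have H k := is_derive_coord z j k; split=> [k|]; first by have [] := H k.
rewrite (dotd_val (H 0)) (dotd_val (H 1)) mul1r.
by have [->|->] := ord2P j; rewrite /= ?mulr1 ?mulr0 ?addr0 ?add0r.
Qed.

Lemma smooth_on_fibre_euler r D f z : open D -> fibre_conic D -> smooth_on D f ->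
  fibre_homogeneous r D f -> D z -> fibre_euler r f z.
Proof.
move=> oD cD sf hf Dz; split=> [k|]; last exact: (euler_fibre oD cD sf hf Dz).
by have [] := smooth_on_dotd k sf Dz.
Qed.

(** An auxiliary Euclidean norm: dividing by it gives coefficients along $n$ by one formula valid
    wherever $y \ne 0$, without choosing a nonzero component. *)
Definition fibre_sqnorm z : R := z.2 0 0 * z.2 0 0 + z.2 0 1 * z.2 0 1.

Definition fibre_normal z i : R := if i == 0 then - z.2 0 1 else z.2 0 0.

(** The constant $\dot\partial_k n_i$. *)
Definition fibre_normal_dir k i : R := if i == 0 then - (1 == k)%:R else (0 == k)%:R.

Lemma is_derive_fibre_normal z i k :
  is_derive z (fibre_dir k) (fun w => fibre_normal w i) (fibre_normal_dir k i).
Proof.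
rewrite /fibre_normal_dir /fibre_normal.
by have [->|->] := ord2P i => /=; [apply: is_derive_fopp|]; exact: is_derive_coord.
Qed.

Lemma fibre_sqnorm_neq0 z : z.2 != 0 -> fibre_sqnorm z != 0.
Proof.
apply: contraNneq; rewrite /fibre_sqnorm -!expr2 => /eqP.
rewrite paddr_eq0 ?sqr_ge0// !sqrf_eq0 => /andP[/eqP y0 /eqP y1].
by apply/eqP/rowP => i; rewrite mxE; have [->|->] := ord2P i.
Qed.

Lemma fibre_euler_sqnorm z : fibre_euler 2 fibre_sqnorm z.
Proof.
have -> : 2 = 1 + 1 :> R by ring.
by apply: fibre_eulerD; apply: fibre_eulerM; exact: fibre_euler_coord.
Qed.

(** The coefficient is the Euclidean projection $(A\cdot n)/|n|^2$. *)
Lemma orthogonal_fibre_normal z (A : 'I_2 -> R) : z.2 != 0 ->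
  z.2 0 0 * A 0 + z.2 0 1 * A 1 = 0 ->
  forall i, A i = (z.2 0 0 * A 1 - z.2 0 1 * A 0) / fibre_sqnorm z * fibre_normal z i.
Proof.
move=> /fibre_sqnorm_neq0 n0 E i; apply: (mulIf n0).
rewrite mulrAC divfK// /fibre_normal /fibre_sqnorm.
have E0 : z.2 0 0 * A 0 = - (z.2 0 1 * A 1) by apply/eqP; rewrite -addr_eq0 E.
have [->|->] := ord2P i => /=.
  transitivity (z.2 0 0 * (z.2 0 0 * A 0) + A 0 * z.2 0 1 * z.2 0 1); first by ring.
  by rewrite E0; ring.
transitivity (A 1 * z.2 0 0 * z.2 0 0 - z.2 0 1 * (- (z.2 0 1 * A 1))); first by ring.
by rewrite -E0; ring.
Qed.

Definition grad_coef f z : R :=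
  (z.2 0 0 * dotd 1 f z - z.2 0 1 * dotd 0 f z) / fibre_sqnorm z.

Lemma grad_coefE f z i : z.2 != 0 -> fibre_euler 0 f z ->
  dotd i f z = grad_coef f z * fibre_normal z i.
Proof.
move=> z0 [_]; rewrite mul0r => E.
exact: (@orthogonal_fibre_normal z (fun k => dotd k f z) z0 E i).
Qed.

(** A matrix killed by $y$ on both sides is a multiple of $n n^T$, and its trace fixes the multiple.
    The two-sided kernel stands in for symmetry of the matrix. *)
Lemma sym_kernel_2x2 (y0 y1 a b c d : R) :
  y0 * a + y1 * c = 0 -> y0 * b + y1 * d = 0 ->
  y0 * a + y1 * b = 0 -> y0 * c + y1 * d = 0 ->
  [/\ a * (y0 * y0 + y1 * y1) = (a + d) * (- y1 * - y1),
      b * (y0 * y0 + y1 * y1) = (a + d) * (- y1 * y0),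
      c * (y0 * y0 + y1 * y1) = (a + d) * (y0 * - y1) &
      d * (y0 * y0 + y1 * y1) = (a + d) * (y0 * y0)].
Proof.
move=> ac bd ab cd; split; apply: subr0_eq.
- transitivity (y0 * (y0 * a + y1 * c) - y1 * (y0 * c + y1 * d)); first by ring.
  by rewrite ac cd; ring.
- transitivity (y0 * (y0 * b + y1 * d) + y1 * (y0 * a + y1 * b)); first by ring.
  by rewrite ab bd; ring.
- transitivity (y0 * (y0 * c + y1 * d) + y1 * (y0 * a + y1 * c)); first by ring.
  by rewrite ac cd; ring.
- transitivity (y1 * (y0 * c + y1 * d) - y0 * (y0 * a + y1 * c)); first by ring.
  by rewrite ac cd; ring.
Qed.

(** If the Hessian is $\kappa\, n n^T$, its trace is $\kappa |n|^2$; this solves for $\kappa$. *)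
Definition hess_coef F z : R :=
  (dotd 0 (dotd 0 F) z + dotd 1 (dotd 1 F) z) / fibre_sqnorm z.

Section Euler.
Context (D : set coords) (oD : open D) (cD : fibre_conic D)
  (nzD : forall z, D z -> z.2 != 0).

Lemma fibre_euler_dotd r f i z : smooth_on D f -> fibre_homogeneous r D f -> D z ->
  fibre_euler (r - 1) (dotd i f) z.
Proof.
move=> sf hf Dz; apply: (smooth_on_fibre_euler oD cD _ _ Dz).
  exact: smooth_on_dotd_smooth.
exact: fibre_homogeneous_dotd.
Qed.

Lemma fibre_euler_dotd2 r f i j z : smooth_on D f -> fibre_homogeneous r D f -> D z ->
  fibre_euler (r - 1 - 1) (dotd i (dotd j f)) z.
Proof.
move=> sf hf Dz; apply: fibre_euler_dotd => //; first exact: smooth_on_dotd_smooth.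
exact: fibre_homogeneous_dotd.
Qed.

Lemma fibre_euler_grad_coef f z : smooth_on D f -> fibre_homogeneous 0 D f -> D z ->
  fibre_euler (- 2) (grad_coef f) z.
Proof.
move=> sf hf Dz; have n0 := fibre_sqnorm_neq0 (nzD Dz).
(* Degrees of the factors: a coordinate, a first derivative of [f], the inverse square norm. *)
have -> : - 2 = 1 + (0 - 1) + - 2 :> R by ring.
apply: fibre_eulerM; last exact: fibre_eulerV (fibre_euler_sqnorm z).
apply: fibre_eulerD; last apply: fibre_eulerN; apply: fibre_eulerM.
- exact: fibre_euler_coord.
- exact: fibre_euler_dotd.
- exact: fibre_euler_coord.
- exact: fibre_euler_dotd.
Qed.

Lemma fibre_euler_hess_coef F z : smooth_on D F -> fibre_homogeneous 1 D F -> D z ->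
  fibre_euler (- 3) (hess_coef F) z.
Proof.
move=> sF hF Dz; have n0 := fibre_sqnorm_neq0 (nzD Dz).
have -> : - 3 = 1 - 1 - 1 + - 2 :> R by ring.
apply: fibre_eulerM; last exact: fibre_eulerV (fibre_euler_sqnorm z).
by apply: fibre_eulerD; exact: fibre_euler_dotd2.
Qed.

Lemma hess_coefE F z i j : smooth_on D F -> fibre_homogeneous 1 D F -> D z ->
  dotd i (dotd j F) z = hess_coef F z * (fibre_normal z i * fibre_normal z j).
Proof.
move=> sF hF Dz; have z0 := nzD Dz.
have n0 := fibre_sqnorm_neq0 z0.
have sdF k : smooth_on D (dotd k F) by exact: smooth_on_dotd_smooth.
have E k : z.2 0 0 * dotd 0 (dotd k F) z + z.2 0 1 * dotd 1 (dotd k F) z = 0.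
  by have [_] := fibre_euler_dotd k sF hF Dz; rewrite subrr mul0r.
(* Differentiate $y^j\dot\partial_j F = F$ along $y^k$; the two copies of $\dot\partial_k F$
   cancel. *)
have E' k : z.2 0 0 * dotd k (dotd 0 F) z + z.2 0 1 * dotd k (dotd 1 F) z = 0.
  have H := is_derive_fadd
    (is_derive_fmul (is_derive_coord z 0 k) (smooth_on_dotd k (sdF 0) Dz))
    (is_derive_fmul (is_derive_coord z 1 k) (smooth_on_dotd k (sdF 1) Dz)).
  have H1 := dotd_val (is_derive_open_eq oD Dz (g := F)
    (fun w Dw => etrans (euler_fibre oD cD sF hF Dw) (mul1r _)) H).
  have cancel0 (x y a b : R) : x = 1 * x + a + (0 * y + b) -> a + b = 0.
    by clear; lra.
  have cancel1 (x y a b : R) : x = 0 * y + a + (1 * x + b) -> a + b = 0.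
    by clear; lra.
  move: H1; have [->|->] := ord2P k; rewrite /= mulr1n mulr0n.
    by move=> H1; exact: (cancel0 _ _ _ _ H1).
  by move=> H1; exact: (cancel1 _ _ _ _ H1).
apply: (mulIf n0); rewrite /hess_coef mulrAC divfK//.
have := sym_kernel_2x2 (E 0) (E 1) (E' 0) (E' 1).
rewrite /fibre_normal /fibre_sqnorm => -[F00 F01 F10 F11].
have [->|->] := ord2P i; have [->|->] := ord2P j => /=.
- exact: F00.
- exact: F01.
- exact: F10.
- exact: F11.
Qed.

End Euler.
End Fibre.

(** * The modified Berwald frame *)

Lemma det_2x2 (K : comNzRingType) (A : 'M[K]_2) :
  \det A = A 0 0 * A 1 1 - A 0 1 * A 1 0.
Proof.
rewrite (expand_det_row A 0) big_ord_recl big_ord1 /cofactor !det_mx11 !mxE /=.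
have -> : lift 0 (0 : 'I_1) = 1 :> 'I_2 by exact/val_inj.
have -> : lift 1 (0 : 'I_1) = 0 :> 'I_2 by exact/val_inj.
by rewrite expr0 expr1 mul1r mulN1r mulrN.
Qed.

Lemma sum_ord2 (V : nmodType) (f : 'I_2 -> V) : \sum_(i < 2) f i = f 0 + f 1.
Proof. by rewrite big_ord_recl big_ord1; congr (_ + f _); exact/val_inj. Qed.

Section BerwaldFrame.
Context {R : realType}.
Local Notation coords := ('rV[R]_2 * 'rV[R]_2)%type.
Implicit Types (f : coords -> R) (z : coords) (i j k : 'I_2).
Context (D : set coords) (oD : open D) (cD : fibre_conic D)
  (nzD : forall z, D z -> z.2 != 0).
Context (F : coords -> R) (sF : smooth_on D F) (hF : fibre_homogeneous 1 D F)
  (F_neq0 : forall z, D z -> F z != 0)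
  (F_nondegenerate : forall z, D z -> metric_mx F z \in unitmx).

#[local] Opaque dotd.
Let kap := hess_coef F.
Let n := @fibre_normal R.
Let del z := F z * F z * F z * kap z.
Let s z := Num.sqrt (Num.sg (del z) * del z).

Lemma dotd_hess z i j : D z -> is_derive z (fibre_dir i) (dotd j F) (kap z * (n z i * n z j)).
Proof.
move=> Dz; rewrite -(hess_coefE oD cD nzD i j sF hF Dz).
exact: (smooth_on_dotd i (smooth_on_dotd_smooth j sF) Dz).
Qed.

Lemma metricE z i j : D z -> metric F i j z =
  dotd i F z * dotd j F z + F z * kap z * (n z i * n z j).
Proof.
move=> Dz; rewrite /metric.
have dF2 w : D w -> 2 * F w * dotd j F w = dotd j (fun w => F w ^+ 2) w.
  by move=> Dw; rewrite (dotd_val (is_derive_fsqr (smooth_on_dotd j sF Dw))).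
have H := is_derive_fmul (is_derive_fmul (is_derive_cst (2 : R) z (fibre_dir i))
  (smooth_on_dotd i sF Dz)) (dotd_hess i j Dz).
rewrite (dotd_val (is_derive_open_eq oD Dz dF2 H)) /cst.
move: (dotd i F z) (dotd j F z) (F z) (kap z) (n z i) (n z j).
by move=> a b c d e f; field.
Qed.

Lemma euler_F z : D z -> z.2 0 0 * dotd 0 F z + z.2 0 1 * dotd 1 F z = F z.
Proof. by move=> Dz; rewrite (euler_fibre oD cD sF hF Dz) mul1r. Qed.

(** The determinant of $\ell\ell^T + F\kappa\, n n^T$ is $F\kappa\det(\ell,n)^2$, and $\det(\ell,n)
    = y^i\ell_i = F$. *)
Lemma det_metricE z : D z -> \det (metric_mx F z) = del z.
Proof.
move=> Dz; rewrite det_2x2 !mxE !metricE// /n /fibre_normal /=.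
pose E := z.2 0 0 * dotd 0 F z + z.2 0 1 * dotd 1 F z.
transitivity (F z * kap z * (E * E)); rewrite /E.
  move: (F z) (kap z) (dotd 0 F z) (dotd 1 F z) (z.2 0 0) (z.2 0 1).
  by move=> x y a b y0 y1; ring.
by rewrite euler_F// /del; move: (F z) (kap z) => x y; ring.
Qed.

Lemma det_metric_neq0 z : D z -> del z != 0.
Proof. by move=> Dz; rewrite -det_metricE// -unitfE -unitmxE F_nondegenerate. Qed.

Lemma hess_coef_neq0 z : D z -> kap z != 0.
Proof. by move=> /det_metric_neq0; rewrite mulf_eq0 negb_or => /andP[]. Qed.

Lemma sqrt_det_gt0 z : D z -> 0 < s z.
Proof. by move=> Dz; rewrite sqrtr_gt0 -normrEsg normr_gt0 det_metric_neq0. Qed.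

Lemma sqr_sqrt_det z : s z * s z = Num.sg (del z) * del z.
Proof. by rewrite -expr2 sqr_sqrtr// -normrEsg. Qed.

Lemma m_lowE z i : D z -> m_low F i z = s z / F z * n z i.
Proof.
move=> Dz; rewrite /m_low /signature det_metricE// -/(s z) /ell_up /n /fibre_normal.
by case: ifP => _; rewrite ?mulrN ?mulNr mulrAC mulrA.
Qed.

(** Expand $F$ as $y^j\ell_j$. This trades derivatives of $n$ for terms in $\ell$ and $n$, so that
    everything stays in the frame. *)
Lemma normal_dirE z i k : D z ->
  F z * fibre_normal_dir k i = dotd k F z * n z i - dotd i F z * n z k.
Proof.
move=> Dz; rewrite -(euler_F Dz) /n /fibre_normal /fibre_normal_dir.
have [->|->] := ord2P i; have [->|->] := ord2P k => /=; rewrite ?mulr1n ?mulr0n.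
all: by move: (dotd 0 F z) (dotd 1 F z) (z.2 0 0) (z.2 0 1) => a b y0 y1; ring.
Qed.

Lemma exists_normal_neq0 z : D z -> exists i, n z i != 0.
Proof.
move=> Dz; apply/existsP; apply: contraNT (nzD Dz); rewrite negb_exists => /forallP H.
apply/eqP/rowP => i; rewrite mxE.
have := H 0; have := H 1; rewrite !negbK /n /fibre_normal /= oppr_eq0 => /eqP h1 /eqP h0.
by have [->|->] := ord2P i.
Qed.

(** Contracting $g_{ij}m^j = m_i$ with $y^i$ gives $\ell_j m^j = 0$. What remains is $F\kappa\, n_i
    (n_j m^j) = (s/F) n_i$, divided by a nonzero $n_i$. *)
Lemma normal_m_up z : D z ->
  n z 0 * m_up F 0 z + n z 1 * m_up F 1 z = s z / (F z * F z * kap z).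
Proof.
move=> Dz; have G i : metric F i 0 z * m_up F 0 z + metric F i 1 z * m_up F 1 z = m_low F i z.
  pose m := \col_j m_low F j z.
  have mu j : m_up F j z = (invmx (metric_mx F z) *m m) j 0.
    by rewrite mxE; apply: eq_bigr => k _; rewrite [m _ _]mxE.
  have : (metric_mx F z *m (invmx (metric_mx F z) *m m)) i 0 = m_low F i z.
    by rewrite mulmxA mulmxV ?F_nondegenerate// mul1mx mxE.
  by rewrite mxE sum_ord2 -!mu !mxE.
have F0 := F_neq0 Dz; have k0 := hess_coef_neq0 Dz.
have [i ni0] := exists_normal_neq0 Dz.
have lu : dotd 0 F z * m_up F 0 z + dotd 1 F z * m_up F 1 z = 0.
  apply: (mulfI F0); rewrite mulr0.
  have : z.2 0 0 * m_low F 0 z + z.2 0 1 * m_low F 1 z = 0.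
    rewrite !m_lowE// /n /fibre_normal /=.
    by move: (s z / F z) (z.2 0 0) (z.2 0 1) => a y0 y1; ring.
  rewrite -!G !metricE// /n /fibre_normal /= => <-; rewrite -{1}(euler_F Dz).
  move: (dotd 0 F z) (dotd 1 F z) (m_up F 0 z) (m_up F 1 z) (F z) (kap z).
  by move: (z.2 0 0) (z.2 0 1) => y0 y1 a b c d e f; ring.
have := G i; rewrite m_lowE// !metricE// => Gi.
apply: (mulIf ni0); move: lu Gi F0 k0 {G ni0}.
move: (dotd i F z) (dotd 0 F z) (dotd 1 F z) (m_up F 0 z) (m_up F 1 z) (F z) (kap z).
move: (n z i) (n z 0) (n z 1) (s z) => ni n0 n1 sz li l0 l1 u0 u1 x y lu Gi x0 y0.
have {lu}Gi : x * y * ni * (n0 * u0 + n1 * u1) = sz / x * ni.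
  rewrite -Gi; transitivity (li * (l0 * u0 + l1 * u1) + x * y * ni * (n0 * u0 + n1 * u1)).
    by rewrite lu mulr0 add0r.
  by ring.
transitivity ((x * y * ni * (n0 * u0 + n1 * u1)) / (x * y)); first by field; apply/andP.
by rewrite Gi; field; apply/andP.
Qed.

(** Only $n_i m^i$ enters, and $s^2 = \varepsilon\det g$ with $\varepsilon^2 = 1$ removes the
    signature. *)
Lemma semi2E f b z : D z -> (forall i, dotd i f z = b * n z i) ->
  semi2 F f z * s z = b * F z ^+ 2.
Proof.
move=> Dz fb; rewrite /semi2 sum_ord2 !fb /signature det_metricE//.
rewrite -!mulrA -mulrDr normal_m_up//.
transitivity (b * (s z * s z) * Num.sg (del z) * F z / (F z * F z * kap z)).
  by move: (Num.sg _) (F z) (kap z) (s z) => a x y t; rewrite -!mulrA; ring.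
rewrite sqr_sqrt_det; transitivity (b * del z * (Num.sg (del z) * Num.sg (del z)) * F z
    / (F z * F z * kap z)).
  move: (Num.sg (del z)) (del z) (F z) (F z * F z * kap z)^-1 => g d x y.
  by ring.
rewrite -expr2 sqr_sg det_metric_neq0// mulr1.
rewrite /del; move: (F z) (kap z) (F_neq0 Dz) (hess_coef_neq0 Dz) => x y x0 y0.
by field; apply/andP.
Qed.

Lemma sqrt_det_derive z k : D z -> is_derive z (fibre_dir k) s
  (Num.sg (del z) / (2 * s z) *
   (3 * F z ^+ 2 * dotd k F z * kap z + F z ^+ 3 * dotd k kap z)).
Proof.
move=> Dz; have dF := smooth_on_dotd k sF Dz.
have dk := dotd_derivable ((fibre_euler_hess_coef oD cD nzD sF hF Dz).1 k).
have H := is_derive_fmul (is_derive_fmul (is_derive_fmul dF dF) dF) dk.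
have H' := is_derive_chain H (is_derive_sqrt_abs (det_metric_neq0 Dz)).
apply: (@is_derive_eq _ _ _ _ _ _ _ _ H'); rewrite -/kap -/(s z); congr (_ * _).
move: (F z) (kap z) (dotd k F z) (dotd k kap z) => x y a b.
by ring.
Qed.

(** As $\kappa$ has degree $-3$, contraction with $y$ gives $-3F\kappa + 3\kappa F = 0$. *)
Lemma hess_slope z : D z -> exists b, forall k,
  F z * dotd k kap z + 3 * kap z * dotd k F z = b * n z k.
Proof.
move=> Dz; eexists => k.
apply: (@orthogonal_fibre_normal _ z
  (fun k => F z * dotd k kap z + 3 * kap z * dotd k F z) (nzD Dz)).
have [_] := fibre_euler_hess_coef oD cD nzD sF hF Dz; rewrite -/kap => E.
transitivity (F z * (z.2 0 0 * dotd 0 kap z + z.2 0 1 * dotd 1 kap z) +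
  3 * kap z * (z.2 0 0 * dotd 0 F z + z.2 0 1 * dotd 1 F z)).
  move: (F z) (kap z) (dotd 0 F z) (dotd 1 F z) (dotd 0 kap z) (dotd 1 kap z).
  by move: (z.2 0 0) (z.2 0 1) => y0 y1 x y a b c d; ring.
by rewrite E euler_F//; move: (F z) (kap z) => x y; ring.
Qed.

(** Differentiating $\ell_i\ell_j + F\kappa\, n_i n_j$, the terms with $\ell_i$ or $\ell_j$ cancel
    through [normal_dirE]. The rest is the combination of [hess_slope] times $n_i n_j$. *)
Lemma cartanE z b i j k : D z ->
  (forall k, F z * dotd k kap z + 3 * kap z * dotd k F z = b * n z k) ->
  cartan F i j k z = 2^-1 * (b * n z i * n z j * n z k).
Proof.
move=> Dz Hb; rewrite /cartan; congr (_ * _).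
have dF := smooth_on_dotd k sF Dz.
have dk := dotd_derivable ((fibre_euler_hess_coef oD cD nzD sF hF Dz).1 k).
have H := is_derive_fadd (is_derive_fmul (dotd_hess k i Dz) (dotd_hess k j Dz))
  (is_derive_fmul (is_derive_fmul dF dk) (is_derive_fmul
     (is_derive_fibre_normal z i k) (is_derive_fibre_normal z j k))).
rewrite (dotd_val (is_derive_open_eq oD Dz
  (fun w Dw => esym (metricE i j Dw)) H)) -/kap -/(n z i) -/(n z j).
transitivity (kap z * (n z k * n z i) * dotd j F z +
  dotd i F z * (kap z * (n z k * n z j)) +
  ((dotd k F z * kap z + F z * dotd k kap z) * (n z i * n z j) +
   kap z * ((F z * fibre_normal_dir k i) * n z j +
            n z i * (F z * fibre_normal_dir k j)))).
  move: (fibre_normal_dir k i) (fibre_normal_dir k j) (n z i) (n z j) (n z k) (F z).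
  move: (kap z) (dotd i F z) (dotd j F z) (dotd k F z) (dotd k kap z).
  by move=> ? ? ? ? ? ? ? ? ? ? ?; ring.
rewrite !normal_dirE//.
transitivity ((F z * dotd k kap z + 3 * kap z * dotd k F z) * n z i * n z j).
  move: (n z i) (n z j) (n z k) (F z) (kap z) (dotd i F z) (dotd j F z) (dotd k F z).
  by move: (dotd k kap z) => ? ? ? ? ? ? ? ? ?; ring.
by rewrite Hb; move: (n z i) (n z j) (n z k) => ? ? ?; ring.
Qed.

Lemma main_scalarE z b : D z ->
  (forall k, F z * dotd k kap z + 3 * kap z * dotd k F z = b * n z k) ->
  main_scalar F z = F z ^+ 4 * b / (2 * s z ^+ 3).
Proof.
move=> Dz Hb; have F0 := F_neq0 Dz; have s0 := lt0r_neq0 (sqrt_det_gt0 Dz).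
apply: xget_unique => [i j k|t /= Ht].
  rewrite (cartanE i j k Dz Hb) !m_lowE//.
  move: (F z) (s z) (n z i) (n z j) (n z k) F0 s0 => x y ? ? ? x0 y0.
  by field; apply/andP.
(* Uniqueness of the scalar: test the defining equation on a diagonal component with $m_i \ne 0$. *)
have [i ni0] := exists_normal_neq0 Dz.
have := Ht i i i; rewrite (cartanE i i i Dz Hb) !m_lowE//.
move: (F z) (s z) (n z i) ni0 F0 s0 => x y m m0 x0 y0 E.
have c0 : (y / x * m) ^+ 3 != 0 by rewrite expf_neq0// !mulf_neq0// invr_eq0.
apply: (mulIf c0); transitivity (t * (y / x * m) * (y / x * m) * (y / x * m)).
  by ring.
rewrite -E.
by field; apply/andP.
Qed.

End BerwaldFrame.

(** * Conformal change *)

(* With n = (-y2, y1) one has m_i = (s / F) n_i; the remaining letters are the *)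
(* coefficients of d phi, of d kappa and of the derivative of [grad_coef phi]. *)
Lemma conformal_coefficients (K : fieldType) (F s a b c eps p q I : K) :
  F != 0 -> s != 0 -> 2 != 0 :> K ->
  p * s = a * F ^+ 2 ->
  q * s = (F * c / s - a * eps * F ^+ 4 * b / (2 * s ^+ 3)) * F ^+ 2 ->
  I = F ^+ 4 * b / (2 * s ^+ 3) ->
  p * (s / F) = a * F /\
  (q + eps * I * p + 2 * p ^+ 2) * (s / F) ^+ 2 = F * c + 2 * a ^+ 2 * F ^+ 2.
Proof.
move=> F0 s0 two0 ps qs ->.
have -> : p = a * F ^+ 2 / s by rewrite -ps mulfK.
have -> : q = (F * c / s - a * eps * F ^+ 4 * b / (2 * s ^+ 3)) * F ^+ 2 / s.
  by rewrite -qs mulfK.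
split; first by field; apply/andP.
by field; rewrite s0 F0 two0.
Qed.

Section Conformal.
Context {R : realType}.
Local Notation coords := ('rV[R]_2 * 'rV[R]_2)%type.
Implicit Types (f : coords -> R) (z : coords) (i j k : 'I_2).
Context (D : set coords) (oD : open D) (cD : fibre_conic D)
  (nzD : forall z, D z -> z.2 != 0).
Context (F : coords -> R) (sF : smooth_on D F) (hF : fibre_homogeneous 1 D F)
  (F_neq0 : forall z, D z -> F z != 0)
  (F_nondegenerate : forall z, D z -> metric_mx F z \in unitmx).
Context (phi : coords -> R) (sphi : smooth_on D phi)
  (hphi : fibre_homogeneous 0 D phi).

#[local] Opaque dotd.
Let kap := hess_coef F.
Let n := @fibre_normal R.
Let del z := F z * F z * F z * kap z.
Let s z := Num.sqrt (Num.sg (del z) * del z).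
Let a := grad_coef phi.

Lemma dotd_degree0 z i : D z -> dotd i phi z = a z * n z i.
Proof.
move=> Dz; apply: grad_coefE (nzD Dz) _.
exact: (smooth_on_fibre_euler oD cD sphi hphi Dz).
Qed.

Lemma grad_coef_derive z k : D z -> is_derive z (fibre_dir k) a (dotd k a z).
Proof.
move=> Dz; apply: dotd_derivable.
exact: (fibre_euler_grad_coef oD cD nzD sphi hphi Dz).1.
Qed.

Lemma dotd2_degree0 z i j : D z -> dotd i (dotd j phi) z =
  dotd i a z * n z j + a z * fibre_normal_dir i j.
Proof.
move=> Dz; apply: dotd_val.
have H := is_derive_fmul (grad_coef_derive i Dz) (is_derive_fibre_normal z j i).
exact: (is_derive_open_eq oD Dz (fun w Dw => esym (dotd_degree0 j Dw)) H).
Qed.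

(** As $a$ has degree $-2$, contraction with $y$ gives $-2aF + 2aF = 0$. *)
Lemma grad_slope z : D z -> exists c, forall k,
  F z * dotd k a z + 2 * a z * dotd k F z = c * n z k.
Proof.
move=> Dz; eexists => k.
apply: (@orthogonal_fibre_normal _ z
  (fun k => F z * dotd k a z + 2 * a z * dotd k F z) (nzD Dz)).
have [_] := fibre_euler_grad_coef oD cD nzD sphi hphi Dz; rewrite -/a => E.
transitivity (F z * (z.2 0 0 * dotd 0 a z + z.2 0 1 * dotd 1 a z) +
  2 * a z * (z.2 0 0 * dotd 0 F z + z.2 0 1 * dotd 1 F z)).
  move: (F z) (a z) (dotd 0 F z) (dotd 1 F z) (dotd 0 a z) (dotd 1 a z).
  by move: (z.2 0 0) (z.2 0 1) => ? ? ? ? ? ? ? ?; ring.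
rewrite E (euler_F oD cD sF hF Dz).
by move: (F z) (a z) => x y; ring.
Qed.

Lemma semi2_degree0 z : D z -> semi2 F phi z * s z = a z * F z ^+ 2.
Proof.
move=> Dz; apply: (semi2E oD cD nzD sF hF F_neq0 F_nondegenerate Dz) => i.
exact: dotd_degree0.
Qed.

(** Quotient rule on $\phi_{;2} = aF^2/s$: the numerator produces the combination of [grad_slope],
    the derivative of $s$ that of [hess_slope]. *)
Lemma dotd_semi2_degree0 z b c k : D z ->
  (forall k, F z * dotd k kap z + 3 * kap z * dotd k F z = b * n z k) ->
  (forall k, F z * dotd k a z + 2 * a z * dotd k F z = c * n z k) ->
  dotd k (semi2 F phi) z =
  (F z * c / s z - a z * Num.sg (del z) * F z ^+ 4 * b / (2 * s z ^+ 3)) * n z k.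
Proof.
move=> Dz Hb Hc; have sne w (Dw : D w) : s w != 0.
  exact: lt0r_neq0 (sqrt_det_gt0 oD cD nzD sF hF F_nondegenerate Dw).
have dF := smooth_on_dotd k sF Dz.
have H := is_derive_fdiv (sne z Dz) (is_derive_fmul (grad_coef_derive k Dz)
  (is_derive_fsqr dF)) (sqrt_det_derive oD cD nzD sF hF F_nondegenerate k Dz).
have Ep w : D w -> a w * F w ^+ 2 / s w = semi2 F phi w.
  by move=> Dw; rewrite -semi2_degree0// mulfK// sne.
rewrite (dotd_val (is_derive_open_eq oD Dz Ep H)) -/kap -/(s z) -/(del z).
have := Hb k; have := Hc k; have := F_neq0 Dz; have := sne z Dz.
move: (Num.sg (del z)) (F z) (s z) (kap z) (dotd k F z) (dotd k kap z) (a z).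
move: (dotd k a z) (n z k) => ak nk g x y u xk uk w y0 x0 ck bk.
transitivity (x * (x * ak + 2 * w * xk) / y
   - w * g * x ^+ 4 * (x * uk + 3 * u * xk) / (2 * y ^+ 3)).
  by field.
by rewrite ck bk; field.
Qed.

Lemma metric_conformal (Fb : coords -> R) z i j :
  (forall w, D w -> Fb w = expR (phi w) * F w) -> D z ->
  metric Fb i j z = expR (2 * phi z) * (metric F i j z
    + 2 * F z * (dotd i phi z * dotd j F z + dotd j phi z * dotd i F z)
    + 2 * F z ^+ 2 * (dotd i phi z * dotd j phi z)
    + F z ^+ 2 * dotd i (dotd j phi) z).
Proof.
move=> FbE Dz; rewrite (metricE oD cD nzD sF hF i j Dz) -/kap -/(n z i) -/(n z j) /metric.
pose h w := expR (phi w).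
have dh k w : D w -> is_derive w (fibre_dir k) h (h w * dotd k phi w).
  by move=> Dw; exact: (is_derive_chain (smooth_on_dotd k sphi Dw) (is_derive_expR _)).
have dFb k w : D w -> is_derive w (fibre_dir k) (fun w => h w * F w)
    (h w * dotd k phi w * F w + h w * dotd k F w).
  by move=> Dw; exact: (is_derive_fmul (dh k w Dw) (smooth_on_dotd k sF Dw)).
have dFb2 w : D w -> 2 * (h w * F w) *
    (h w * dotd j phi w * F w + h w * dotd j F w) = dotd j (fun w => Fb w ^+ 2) w.
  move=> Dw; have H := is_derive_fsqr (dFb j w Dw).
  apply/esym/dotd_val/(is_derive_open_eq oD Dw _ H) => y Dy.
  by rewrite FbE.
have H := is_derive_fmul
  (is_derive_fmul (is_derive_cst (2 : R) z (fibre_dir i)) (dFb i z Dz))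
  (is_derive_fadd
     (is_derive_fmul (is_derive_fmul (dh i z Dz)
        (smooth_on_dotd i (smooth_on_dotd_smooth j sphi) Dz))
        (smooth_on_dotd i sF Dz))
     (is_derive_fmul (dh i z Dz) (dotd_hess oD cD nzD sF hF i j Dz))).
rewrite (dotd_val (is_derive_open_eq oD Dz dFb2 H)) /cst -/kap -/(n z i) -/(n z j).
have -> : expR (2 * phi z) = h z * h z by rewrite /h -expRD -mulr2n mulr_natl.
move: (h z) (F z) (kap z) (n z i) (n z j) (dotd i phi z) (dotd j phi z).
move: (dotd i F z) (dotd j F z) (dotd i (dotd j phi) z).
by move=> ? ? ? ? ? ? ? ? ? ?; field.
Qed.

Lemma conformal_metricE (Fb : coords -> R) z i j :
  (forall w, D w -> Fb w = expR (phi w) * F w) -> D z ->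
  let eps := signature F z in
  let l k := ell_low F k z in
  let m k := m_low F k z in
  let phi2 := semi2 F phi in
  let phi22 := semi2 F phi2 in
  let sigma := phi22 z + eps * main_scalar F z * phi2 z + 2 * phi2 z ^+ 2 in
  metric Fb i j z =
    expR (2 * phi z) *
    (metric F i j z + phi2 z * (l i * m j + l j * m i) + sigma * (m i * m j))
  /\
  metric Fb i j z =
    expR (2 * phi z) *
    (l i * l j + phi2 z * (l i * m j + l j * m i)
     + (sigma + eps) * (m i * m j)).
Proof.
move=> FbE Dz eps l m phi2 phi22 sigma.
have epsE : eps = Num.sg (del z) by rewrite /eps /signature (det_metricE oD cD nzD sF hF Dz).
have mE k : m k = s z / F z * n z k.
  exact: (m_lowE oD cD nzD sF hF k Dz).
have F0 := F_neq0 Dz.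
have s0 : s z != 0 by exact: lt0r_neq0 (sqrt_det_gt0 oD cD nzD sF hF F_nondegenerate Dz).
have [b Hb] := hess_slope oD cD nzD sF hF Dz.
have [c Hc] := grad_slope Dz.
have IE := main_scalarE oD cD nzD sF hF F_neq0 F_nondegenerate Dz Hb.
have qE := semi2E oD cD nzD sF hF F_neq0 F_nondegenerate Dz
  (fun k => dotd_semi2_degree0 k Dz Hb Hc).
have two0 : 2 != 0 :> R by rewrite pnatr_eq0.
have [pE sE] := conformal_coefficients F0 s0 two0 (semi2_degree0 Dz) qE IE.
rewrite -epsE -/phi2 -/phi22 -/sigma in pE sE.
have first_form : metric Fb i j z = expR (2 * phi z) *
    (metric F i j z + phi2 z * (l i * m j + l j * m i) + sigma * (m i * m j)).
  rewrite (metric_conformal i j FbE Dz); congr (_ * _); rewrite -!addrA; congr (_ + _).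
  have -> : sigma * (m i * m j) = sigma * (s z / F z) ^+ 2 * (n z i * n z j).
    by rewrite !mE; move: (sigma) (s z / F z) (n z i) (n z j) => ? ? ? ?; ring.
  have -> : phi2 z * (l i * m j + l j * m i) =
      phi2 z * (s z / F z) * (l i * n z j + l j * n z i).
    by rewrite !mE; move: (phi2 z) (s z / F z) (n z i) (n z j) (l i) (l j) => *; ring.
  rewrite pE sE dotd2_degree0// !dotd_degree0//.
  (* One factor $F$ is moved onto each derivative of $a$ and $n$, exposing the left-hand sides of
     [Hc] and [normal_dirE]. *)
  transitivity (2 * F z * (a z * n z i * l j + a z * n z j * l i) +
    (2 * F z ^+ 2 * (a z * n z i * (a z * n z j)) +
     F z * ((F z * dotd i a z) * n z j + a z * (F z * fibre_normal_dir i j)))).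
    rewrite /l /ell_low; move: (fibre_normal_dir i j) (n z i) (n z j) (dotd i a z).
    move: (dotd i F z) (dotd j F z) (a z) (F z).
    by move=> ? ? ? ? ? ? ? ?; ring.
  rewrite (normal_dirE oD cD sF hF j i Dz) -/(n z j) -/(n z i).
  have -> : F z * dotd i a z = c * n z i - 2 * a z * dotd i F z by rewrite -Hc addrK.
  rewrite /l /ell_low; move: (n z i) (n z j).
  move: (dotd i F z) (dotd j F z) (a z) (F z).
  by move=> ? ? ? ? ? ?; ring.
split; first exact: first_form.
rewrite first_form (metricE oD cD nzD sF hF i j Dz) -/kap -/(n z i) -/(n z j); congr (_ * _).
(* Since $m_i m_j = (s^2/F^2) n_i n_j$ and $\varepsilon s^2 = \det g = F^3\kappa$. *)
have -> : F z * kap z * (n z i * n z j) = eps * (m i * m j).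
  have d0 : del z != 0 := det_metric_neq0 oD cD nzD sF hF F_nondegenerate Dz.
  transitivity (eps * (s z * s z) / F z ^+ 2 * (n z i * n z j)); last first.
    by rewrite !mE; move: (s z) (F z) F0 (eps) (n z i) (n z j) => ? x x0 *; field.
  have -> : eps * (s z * s z) = del z.
    have -> : s z * s z = Num.sg (del z) * del z by exact: sqr_sqrt_det.
    by rewrite epsE mulrA -(expr2 (Num.sg (del z))) sqr_sg d0 mul1r.
  congr (_ * _); rewrite /del /kap.
  by move: (hess_coef F z) (F z) F0 => u x x0; field.
rewrite /l /ell_low; move: (sigma) (eps) (m i) (m j) (phi2 z).
move: (dotd i F z) (dotd j F z).
by move=> ? ? ? ? ? ? ?; ring.
Qed.

End Conformal.

(** * Functions on the tangent bundle in induced coordinates *)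

Section InducedCoordinates.
Context {R : realType} {M : smooth_surface R}.
Implicit Types (c : chart R M) (v w : tangent M) (A : set (tangent M)).

(** [cinv] recovers the base point; the transition rule then fixes the fibre coordinates in atlas
    charts around it, and all others are 0. *)
Lemma tcoords_inj c v w : atlas c -> cdom c (tpt v) -> cdom c (tpt w) ->
  tcoords c v = tcoords c w -> v = w.
Proof.
case: v => p t t_out t_change; case: w => q u u_out u_change /= hc cp cq.
rewrite /tcoords /= => -[pq tu].
have {}pq : p = q by rewrite -(cmapK cp) -(cmapK cq) pq.
subst q; have {}tu : t = u.
  apply/funext => c'; have [[ac' c'p]|c'p] := pselect (atlas c' /\ cdom c' p).
    by rewrite (t_change c c') // (u_change c c') // tu.
  by rewrite t_out // u_out.
subst u; congr Tangent; exact: Prop_irrelevance.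
Qed.

(** By injectivity of the induced coordinates, the choice made by [xget] has only one candidate. *)
Lemma local_rep_tcoords c A (f : tangent M -> R) v : atlas c -> A v ->
  cdom c (tpt v) -> local_rep c A f (tcoords c v) = f v.
Proof.
move=> hc Av cv; apply: xget_unique; first by exists v.
by move=> _ [w [_ [cw wv]] <-]; rewrite (tcoords_inj hc cw cv wv).
Qed.

Lemma coord_image_conic c A : conic_subbundle A -> fibre_conic (coord_image c A).
Proof.
move=> [_ _ _ _ cA] a _ a0 [v [Av cv] <-]; exists (tscale a v) => //.
by split => //; exact: cA.
Qed.

(** If the coordinates vanished in [c], the Jacobian rule would make them vanish in every chart. *)
Lemma coord_image_neq0 c A z : atlas c -> conic_subbundle A -> coord_image c A z ->
  z.2 != 0.
Proof.
move=> hc [_ _ nzA _ _] [v [Av cv] <-]; apply/eqP => /= v0.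
apply: (nzA v Av) => c'; have [[ac' c'v]|] := pselect (atlas c' /\ cdom c' (tpt v)).
  by rewrite (tcoord_change hc ac' cv c'v) v0 mul0mx.
exact: tcoord_out.
Qed.

Lemma local_rep_homogeneous r c A (f : tangent M -> R) : atlas c ->
  conic_subbundle A -> pos_homogeneous r A f ->
  fibre_homogeneous r (coord_image c A) (local_rep c A f).
Proof.
move=> hc [_ _ _ _ cA] hf a _ a0 [v [Av cv] <-].
rewrite -[(_, _)]/(tcoords c (tscale a v)).
rewrite !local_rep_tcoords//; last exact: cA.
exact: hf.
Qed.

End InducedCoordinates.

Unset Implicit Arguments.

Theorem proposition2p10 (R : realType) (M : smooth_surface R)
    (A : set (tangent M)) (F phi : tangent M -> R)
    (hF : conic_pseudo_finsler A F)
    (F_neq0 : forall v : tangent M, A v -> F v != 0)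
    (phi_smooth : tangent_smooth A phi)
    (phi_homogeneous : pos_homogeneous 0 A phi)
    (c : chart R M) (hc : atlas c)
    (v : tangent M) (Av : A v) (cv : cdom c (tpt v)) (i j : 'I_2) :
  let z := tcoords c v in
  let Fc := local_rep c A F in
  let phic := local_rep c A phi in
  let Fbar := local_rep c A (fun w : tangent M => expR (phi w) * F w) in
  let eps := signature Fc z in
  let l k := ell_low Fc k z in
  let m k := m_low Fc k z in
  let phi2 := semi2 Fc phic in
  let phi22 := semi2 Fc phi2 in
  let sigma := phi22 z + eps * main_scalar Fc z * phi2 z + 2 * phi2 z ^+ 2 in
  metric Fbar i j z =
    expR (2 * phic z) *
    (metric Fc i j z + phi2 z * (l i * m j + l j * m i) + sigma * (m i * m j))
  /\
  metric Fbar i j z =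
    expR (2 * phic z) *
    (l i * l j + phi2 z * (l i * m j + l j * m i)
     + (sigma + eps) * (m i * m j)).
Proof.
have [cA F_smooth F_homogeneous F_nondegenerate] := hF.
have [_ oA _ _ _] := cA.
apply: (conformal_metricE (oA c hc) (coord_image_conic cA)
  (fun z => coord_image_neq0 hc cA) (F_smooth c hc)
  (local_rep_homogeneous hc cA F_homogeneous) _ (F_nondegenerate c hc)
  (phi_smooth c hc) (local_rep_homogeneous hc cA phi_homogeneous)).
- by move=> _ [w [Aw cw] <-]; rewrite local_rep_tcoords// F_neq0.
- by move=> _ [w [Aw cw] <-]; rewrite !local_rep_tcoords.
- by exists v.
Qed.
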